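(* Let $A$ be compact, let $g(x,\mu)$ be lower semicontinuous on $A \times B(\mu_0,r)$ for some $r > 0$, and let the function $\beta$ be strictly increasing. Then the penalty function $F_\lambda$ is globally exact if and only if it is (locally) exact at every globally optimal solution of the problem $(\mathcal{P})$, and there exists $\lambda_0 \ge 0$ such that $F_{\lambda_0}(x,\mu)$ is bounded below on $A \times P$.
   Context: Setting. Let $X$ be a topological space, $f \colon X \to \mathbb{R} \cup \{+\infty\}$ a given function, and $M, A \subset X$ nonempty sets with $M \cap A \neq \emptyset$. The problem $(\mathcal{P})$ is: minimize $f(x)$ subject to $x \in M$, $x \in A$. Its set of feasible points is $\Omega = M \cap A$, and a globally optimal solution of $(\mathcal{P})$ is a point of global minimum of $f$ on $\Omega$. It is assumed that $f$ is bounded below on $\Omega$. Write $\mathbb{R}_+ = [0,+\infty)$ and $\operatorname{dom} f = \{x \in X \mid f(x) < +\infty\}$. Let $(P,d)$ be a metric space (of perturbation parameters), and let $g \colon X \times P \to \mathbb{R} \cup \{+\infty\}$ be a perturbed objective function such that there exists $\mu_0 \in P$ for which the following conditions are satisfied: (i) (consistency condition) $g(x,\mu_0) = f(x)$ for any $x \in \Omega$; (ii) (exact penalization condition) $\operatorname{arg\,min}_{x \in A} g(x,\mu_0) = \operatorname{arg\,min}_{x \in \Omega} f(x)$. Denote $B(\mu_0,r) = \{\mu \in P \mid d(\mu,\mu_0) \le r\}$. Let $\beta \colon \mathbb{R}_+ \to \mathbb{R}_+ \cup \{+\infty\}$ be a function such that $\beta(t) = 0$ if and only if $t = 0$. For any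 $\lambda \ge 0$ the penalty function is $$F_\lambda(x,\mu) = g(x,\mu) + \lambda \beta(d(\mu,\mu_0)),$$ and the penalized problem is to minimize $F_\lambda(x,\mu)$ over $(x,\mu) \in A \times P$. Local exactness: let $x^* \in \operatorname{dom} f$ be a point of local minimum of the problem $(\mathcal{P})$. The penalty function $F_\lambda$ is called (locally) exact at $x^*$ if there exists $\lambda \ge 0$ such that $(x^*,\mu_0)$ is a point of local minimum of the penalized problem. Global exactness: the penalty function $F_\lambda$ is said to be (globally) exact if there exists $\lambda \ge 0$ such that $F_\lambda$ attains a global minimum on the set $A \times P$, and if $(x^*,\mu^* ) \in A \times P$ is a globally optimal solution of the penalized problem, then $\mu^* = \mu_0$.
   Formalization: The formal theorem additionally assumes that f is finite at some feasible point (Ω ∩ dom f is nonempty); if f is identically +∞ on Ω, local exactness at optimal solutions is undefined and the equivalence can fail. *)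

(* Defs.v *)
From mathcomp Require Import all_boot all_order all_algebra.
From mathcomp Require Import all_classical all_reals all_analysis.

Set Implicit Arguments.
Unset Strict Implicit.
Unset Printing Implicit Defensive.

Import Order.TTheory GRing.Theory Num.Theory.
Import numFieldNormedType.Exports.

Local Open Scope classical_set_scope.
Local Open Scope ring_scope.
Local Open Scope ereal_scope.

Definition dom (R : realType) (T : Type) (h : T -> \bar R) : set T :=
  [set x | h x < +oo].

Definition argmin (R : realType) (T : Type) (S : set T) (h : T -> \bar R) :
    set T :=
  [set x | S x /\ forall y, S y -> h x <= h y].

Definition local_argmin (R : realType) (T : topologicalType) (S : set T)
    (h : T -> \bar R) : set T :=
  [set x | S x /\ \forall y \near within S (nbhs x), h x <= h y].

Definition bounded_below_on (R : realType) (T : Type) (S : set T)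
    (h : T -> \bar R) : Prop :=
  exists c : R, forall x, S x -> c%:E <= h x.

Definition mclosed_ball (R : realType) (P : metricType R) (m0 : P) (r : R) :
    set P :=
  [set m | (mdist m m0 <= r)%R].

                                                                                
                                                                                
Definition lsc_on (R : realType) (T : topologicalType) (S : set T)
    (h : T -> \bar R) : Prop :=
  lower_semicontinuous (h : subspace S -> \bar R).

                                                                                
Definition penalty (R : realType) (X : Type) (P : metricType R)
    (g : X * P -> \bar R) (beta : R -> \bar R) (m0 : P) (lambda : R) :
    X * P -> \bar R :=
  fun z => g z + lambda%:E * beta (mdist z.2 m0).

                                                                                
Definition locally_exact (R : realType) (X : topologicalType)
    (P : metricType R) (A : set X) (g : X * P -> \bar R) (beta : R -> \bar R)
    (m0 : P) (xs : X) : Prop :=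
  exists lambda : R, (0 <= lambda)%R /\
    local_argmin (A `*` [set: P]) (penalty g beta m0 lambda) (xs, m0).

Definition globally_exact (R : realType) (X : topologicalType)
    (P : metricType R) (A : set X) (g : X * P -> \bar R) (beta : R -> \bar R)
    (m0 : P) : Prop :=
  exists lambda : R, [/\ (0 <= lambda)%R,
    argmin (A `*` [set: P]) (penalty g beta m0 lambda) !=set0 &
    forall (xs : X) (ms : P),
      argmin (A `*` [set: P]) (penalty g beta m0 lambda) (xs, ms) -> ms = m0].

(* Main.v *)
Require Import Defs.
From mathcomp Require Import all_boot all_order all_algebra.
From mathcomp Require Import all_classical all_reals all_analysis.
From mathcomp Require Import lra.

(** Let [v] be the minimum of [g (., m0)] over [A]. It is attained, because
    [g (., m0)] is lower semicontinuous on the compact set [A]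
    ([compact_lsc_argmin]); by the exact penalization condition it is the
    optimal value of the constrained problem, and it is finite because [f] is
    proper. Since [F_lambda (x, m0) = g (x, m0)], everything amounts to
    the lower bound [v <= F_lambda] on [A `*` P].

    If [F_lambda] is globally exact, its minimizers lie over [m0], so its
    minimum value is [v]. Then [v] bounds [F_lambda] from below, and every
    solution [x] of the constrained problem gives a global, hence local,
    minimizer [(x, m0)].

    Conversely, the lower bound is obtained for large [lambda] on two regions.
    - Close to [m0] ([near_penalty_ge]): around a point [(x, m0)] where
      [g (x, m0) = v] it is local exactness; around a point where
      [v < g (x, m0)] it is lower semicontinuity, already with [lambda = 0].
      Compactness of [A] makes both the neighbourhood of [m0] and the size
      of [lambda] uniform in [x].
    - At distance at least [e] from [m0] ([far_penalty_ge]): there [beta] is at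
      least [beta e > 0], so raising [lambda] lifts the bound below
      [F_lambda0] above [v].
    Once [v <= F_lambda] holds for one [lambda], any strictly larger parameter
    leaves no minimizer outside [m0] ([globally_exact_of_lower_bound]).

    Strict monotonicity makes [beta] finite on nonnegative reals, as
    [beta t < beta (t + 1) <= +oo]; this is what allows arithmetic with
    [lambda * beta]. *)

Import Order.TTheory GRing.Theory Num.Theory.
Import numFieldNormedType.Exports.

Local Open Scope classical_set_scope.
Local Open Scope ring_scope.
Local Open Scope ereal_scope.

(** * Lower semicontinuity on a subset *)

Lemma lsc_on_near {R : realType} {T : topologicalType} {S : set T}
    {h : T -> \bar R} {x : T} {a : R} :
  lsc_on S h -> S x -> a%:E < h x ->
  \forall y \near x, S y -> a%:E < h y.
Proof.
move=> hlsc Sx ax; have [V] := hlsc x a ax.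
rewrite {1}/nbhs/= -nbhs_subspace_in// => nV Va.
exact: filterS Va nV.
Qed.

Lemma lsc_on_slice (R : realType) (X Y : topologicalType) (A : set X)
    (B : set Y) (g : X * Y -> \bar R) (y : Y) :
  lsc_on (A `*` B) g -> B y -> lsc_on A (fun x => g (x, y)).
Proof.
move=> glsc By x a ax; have [Ax|nAx] := pselect (A x); last first.
  exists [set x]; last by move=> _ ->.
  by rewrite {1}/nbhs/= -nbhs_subspace_out.
have [[U V] /= [nU nV] UV] := lsc_on_near glsc (conj Ax By : (A `*` B) (x, y)) ax.
exists (U `&` A).
  rewrite {1}/nbhs/= -nbhs_subspace_in//.
  by apply: filterS nU => z Uz Az.
move=> z [Uz Az]; apply: (UV (z, y)); split => //=.
exact: nbhs_singleton nV.
Qed.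

(** Without a minimizer, every [x] in [A] satisfies [h x0 < h x] for some
    [x0] in [A], and by semicontinuity this persists near [x]. The sublevel
    sets of the values of [h] on [A] form a filter basis, so compactness
    yields a single [x0] in [A] with [h x0 < h x] for all [x] in [A], which
    fails at [x0] itself. *)
Lemma compact_lsc_argmin (R : realType) (T : topologicalType) (A : set T)
    (h : T -> \bar R) :
  compact A -> A !=set0 -> (forall x, -oo < h x) -> lsc_on A h ->
  argmin A h !=set0.
Proof.
move=> /compact_near_coveringP/near_covering_withinP cA A0 hNy hlsc.
apply: contrapT => nomin.
pose F := filter_from A (fun x0 => [set x | h x <= h x0]).
have FF : Filter F.
  apply: filter_from_filter => // x y Ax Ay.
  have [xy|/ltW yx] := leP (h x) (h y).
    by exists x => // z /= zx; split => //; exact: le_trans zx xy.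
  by exists y => // z /= zy; split => //; exact: le_trans zy yx.
have [|x0 Ax0 /(_ _ (lexx _) _ Ax0)] := cA T F (fun i x => h i < h x) FF;
  last by rewrite ltxx.
move=> x Ax.
have [x0 Ax0 x0x] : exists2 x0, A x0 & h x0 < h x.
  apply: contrapT => nx0; apply: nomin; exists x; split => // y Ay.
  by rewrite leNgt; apply/negP => yx; apply: nx0; exists y.
(* semicontinuity is stated with real thresholds, so [h x0] must be real *)
have hx0 : h x0 \is a fin_num.
  by rewrite fin_real// hNy/= (lt_le_trans x0x)// leey.
rewrite -(fineK hx0) in x0x.
exists ([set y | A y -> (fine (h x0))%:E < h y], [set i | h i <= h x0]).
  split; first exact: lsc_on_near.
  by exists x0.
move=> [y i] /= [yx0 ix0] Ay.
by rewrite (le_lt_trans ix0)// -(fineK hx0) yx0.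
Qed.

(** * Lower bounds on the penalty function *)

Lemma penalty_base (R : realType) (X : Type) (P : metricType R)
    (g : X * P -> \bar R) (beta : R -> \bar R) (m0 : P) (lambda : R) (x : X) :
  beta 0%R = 0 -> penalty g beta m0 lambda (x, m0) = g (x, m0).
Proof. by move=> beta0; rewrite /penalty/= mdistxx beta0 mule0 adde0. Qed.

Lemma le_penalty (R : realType) (X : Type) (P : metricType R)
    (g : X * P -> \bar R) (beta : R -> \bar R) (m0 : P) (l1 l2 : R)
    (z : X * P) :
  (forall t : R, (0 <= t)%R -> 0 <= beta t) -> (l1 <= l2)%R ->
  penalty g beta m0 l1 z <= penalty g beta m0 l2 z.
Proof.
move=> beta_ge0 l12; rewrite /penalty leeD2l// lee_wpmul2r ?lee_fin//.
exact/beta_ge0/mdist_ge0.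
Qed.

(** Quantifying over the product of the filters at [+oo] and at [m0] lets one
    compactness argument choose the penalty parameter and the neighbourhood
    of [m0] simultaneously; monotonicity in [lambda] turns the parameter
    found at each point into a statement about all large parameters. *)
Lemma near_penalty_ge (R : realType) (X : topologicalType) (P : metricType R)
    (A : set X) (g : X * P -> \bar R) (beta : R -> \bar R) (m0 : P) (r v : R) :
  compact A -> (0 < r)%R -> lsc_on (A `*` mclosed_ball m0 r) g ->
  (forall t : R, (0 <= t)%R -> 0 <= beta t) -> beta 0%R = 0 ->
  (forall x, A x -> v%:E <= g (x, m0)) ->
  (forall x, A x -> g (x, m0) = v%:E -> locally_exact A g beta m0 x) ->
  \forall lambda \near +oo%R & m \near m0,
    forall x, A x -> v%:E <= penalty g beta m0 lambda (x, m).
Proof.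
move=> /compact_near_coveringP/near_covering_withinP cA r0 glsc beta_ge0 beta0.
move=> g_ge g_eq.
have FF : Filter (filter_prod (+oo%R : set_system R) (nbhs m0)).
  exact: filter_prod_filter.
apply: (cA _ _ (fun i x => v%:E <= penalty g beta m0 i.1 (x, i.2)) FF) => x Ax.
suff [l [U [V [nU nV UV]]]] : exists l U V, [/\ nbhs x U, nbhs m0 V &
    forall y m, U y -> V m -> A y -> v%:E <= penalty g beta m0 l (y, m)].
  exists (U, [set i | (l < i.1)%R /\ V i.2]).
    split => //; exists ([set l' | (l < l')%R], V) => //.
    by split => //; apply: nbhs_pinfty_gt; exact: num_real.
  move=> [y [l' m]] /= [Uy [ll' Vm]] Ay; apply: le_trans (UV _ _ Uy Vm Ay) _.
  by apply: le_penalty => //; exact: ltW.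
have [xv|xv] := eqVneq (g (x, m0)) v%:E.
  have [l [_ [_ [[U V] /= [nU nV] UV]]]] := g_eq x Ax xv.
  exists l, U, V; split => // y m Uy Vm Ay.
  rewrite -xv -(penalty_base _ _ _ _ _ _ l _ beta0).
  exact: (UV (y, m)).
have m0r : mclosed_ball m0 r m0 by rewrite /mclosed_ball/= mdistxx ltW.
have vx : v%:E < g (x, m0) by rewrite lt_neqAle eq_sym xv g_ge.
have [[U V] /= [nU nV] UV] :=
  lsc_on_near glsc (conj Ax m0r : (A `*` mclosed_ball m0 r) (x, m0)) vx.
exists 0%R, U, (V `&` ball m0 r); split => //.
  by apply: filterI => //; exact: nbhsx_ballx.
move=> y m Uy [Vm]; rewrite ballEmdist/= metric_sym => /ltW mr Ay.
by rewrite /penalty mul0e adde0 ltW//; exact: (UV (y, m)).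
Qed.

(** Writing [F_lambda = F_lambda0 + (lambda - lambda0) * beta], the first term
    is at least some [c] everywhere, and the second exceeds any bound in
    [lambda], uniformly over the points at distance at least [e], since
    [beta e] is positive. *)
Lemma far_penalty_ge (R : realType) (X : Type) (P : metricType R)
    (A : set X) (g : X * P -> \bar R) (beta : R -> \bar R) (m0 : P)
    (lambda0 e v : R) :
  bounded_below_on (A `*` [set: P]) (penalty g beta m0 lambda0) ->
  (forall t : R, (e <= t)%R -> beta e <= beta t) ->
  0 < beta e ->
  (forall t : R, (0 <= t)%R -> beta t \is a fin_num) ->
  (0 <= e)%R ->
  \forall lambda \near +oo%R, forall x m, A x -> (e <= mdist m m0)%R ->
    v%:E <= penalty g beta m0 lambda (x, m).
Proof.
move=> [c cP] beta_nd be0 beta_fin e0.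
have [b bE] : exists b, beta e = b%:E.
  by exists (fine (beta e)); rewrite fineK// beta_fin.
have b0 : (0 < b)%R by rewrite -lte_fin -bE.
near=> l => x m Ax em.
have l0l : (lambda0 <= l)%R by near: l; apply: nbhs_pinfty_ge; exact: num_real.
(* chosen so that [c + (l - lambda0) * b] reaches [v] *)
have vcl : ((v - c) / b <= l - lambda0)%R.
  by rewrite lerBrDr; near: l; apply: nbhs_pinfty_ge; exact: num_real.
have /cP : (A `*` [set: P]) (x, m) by [].
have := beta_nd _ em; have := beta_fin _ (le_trans e0 em).
rewrite /penalty bE /=; case: (beta (mdist m m0)) => // t _.
rewrite lee_fin -!EFinM => bt.
case: (g (x, m)) => [a| |]; rewrite ?addNye ?addye ?leey//.
rewrite -!EFinD !lee_fin => ca.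
have : ((v - c) <= (l - lambda0) * t)%R.
  rewrite ler_pdivrMr// in vcl; apply: le_trans vcl _.
  by rewrite ler_wpM2l// subr_ge0.
rewrite mulrBl => vc.
lra.
Unshelve. all: by end_near. Qed.


(** * Global exactness *)

(** At [lambda] itself the bound may be attained off [m0], so exactness is
    claimed for [lambda + 1]: a minimizer [(x, m)] with [m != m0] would give
    [F_lambda (x, m) < F_(lambda + 1) (x, m) <= v]. *)
Lemma globally_exact_of_lower_bound (R : realType) (X : topologicalType)
    (P : metricType R) (A : set X) (g : X * P -> \bar R) (beta : R -> \bar R)
    (m0 : P) (lambda v : R) (x0 : X) :
  (0 <= lambda)%R -> (forall z, -oo < g z) ->
  (forall t : R, (0 < t)%R -> 0 < beta t) -> beta 0%R = 0 ->
  (forall t : R, (0 <= t)%R -> beta t \is a fin_num) ->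
  (forall x m, A x -> v%:E <= penalty g beta m0 lambda (x, m)) ->
  A x0 -> g (x0, m0) = v%:E ->
  globally_exact A g beta m0.
Proof.
move=> l0 gNy beta_gt0 beta0 beta_fin F_ge Ax0 gx0.
exists (lambda + 1)%R; split; first by rewrite addr_ge0.
  exists (x0, m0); split => // -[y m] [/= Ay _].
  rewrite penalty_base// gx0 (le_trans (F_ge y m Ay))//.
  apply: le_penalty; last by rewrite lerDl.
  by move=> t; rewrite le_eqVlt => /predU1P[<-|/beta_gt0/ltW//]; rewrite beta0.
move=> x m [[/= Ax _] /(_ (x0, m0) (conj Ax0 I))].
rewrite penalty_base// gx0 => F_le.
apply/eqP; apply: contraT; rewrite -mdist_gt0 => d0.
have := F_ge x m Ax; have := beta_gt0 _ d0; have := beta_fin _ (ltW d0).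
move: F_le (gNy (x, m)); rewrite /penalty/=.
case: (beta (mdist m m0)) => // t; rewrite -!EFinM.
case: (g (x, m)) => [a| |]; rewrite ?addye//.
rewrite -!EFinD !lee_fin => F_le _ _; rewrite lte_fin => t0 vF.
lra.
Qed.

Theorem corollary1 (R : realType) (X : topologicalType) (f : X -> \bar R)
    (M A : set X) (P : metricType R) (g : X * P -> \bar R) (m0 : P)
    (beta : R -> \bar R) (r : R)
    (f_gtNy : forall x, -oo < f x)
    (MA_neq0 : M `&` A !=set0)
    (f_proper : (M `&` A) `&` dom f !=set0)
    (f_bounded : bounded_below_on (M `&` A) f)
    (g_gtNy : forall z, -oo < g z)
    (g_consistent : forall x, (M `&` A) x -> g (x, m0) = f x)
    (g_exact : argmin A (fun x => g (x, m0)) = argmin (M `&` A) f)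
    (beta_ge0 : forall t : R, (0 <= t)%R -> 0 <= beta t)
    (beta_eq0 : forall t : R, (0 <= t)%R -> (beta t = 0 <-> t = 0%R))
    (A_compact : compact A)
    (r_gt0 : (0 < r)%R)
    (g_lsc : lsc_on (A `*` mclosed_ball m0 r) g)
    (beta_incr : forall s t : R, (0 <= s)%R -> (s < t)%R -> beta s < beta t) :
  globally_exact A g beta m0 <->
  (forall xs : X, argmin (M `&` A) f xs -> locally_exact A g beta m0 xs) /\
  (exists lambda0 : R, (0 <= lambda0)%R /\
     bounded_below_on (A `*` [set: P]) (penalty g beta m0 lambda0)).
Proof.
have beta0 : beta 0%R = 0 by exact/beta_eq0.
have beta_gt0 (t : R) : (0 < t)%R -> 0 < beta t.
  by move=> t0; rewrite -beta0; exact: beta_incr.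
have beta_fin (t : R) : (0 <= t)%R -> beta t \is a fin_num.
  move=> t0; rewrite ge0_fin_numE ?beta_ge0//.
  have : beta t < beta (t + 1)%R by rewrite beta_incr// ltrDl.
  by move/lt_le_trans; apply; exact: leey.
(* the optimal value is a real number because f is proper *)
have opt_fin x : argmin A (fun y => g (y, m0)) x -> g (x, m0) \is a fin_num.
  move=> [_ x_min]; have [y [[My Ay] fy]] := f_proper.
  rewrite fin_real// g_gtNy/= (le_lt_trans (x_min y Ay))//.
  by rewrite g_consistent.
split.
  move=> [lambda [lambda_ge0 [[x0 m] x0_min] m_eq]].
  have mE := m_eq _ _ x0_min; rewrite {m}mE in x0_min.
  have [[/= Ax0 _] F_ge] := x0_min.
  rewrite penalty_base// in F_ge.
  have x0_opt : argmin A (fun y => g (y, m0)) x0.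
    split => // y Ay; have := F_ge (y, m0) (conj Ay I).
    by rewrite penalty_base.
  split.
    move=> x; rewrite -g_exact => -[Ax x_min].
    exists lambda; split => //; split => //.
    apply: (@filterE _ (nbhs (x, m0))) => z Sz; rewrite penalty_base//.
    exact: le_trans (x_min _ Ax0) (F_ge z Sz).
  exists lambda; split => //; exists (fine (g (x0, m0))) => z Sz.
  by rewrite fineK ?opt_fin//; exact: F_ge.
move=> [loc_exact [lambda0 [_ F_bounded]]].
have [x0 x0_opt] : argmin A (fun y => g (y, m0)) !=set0.
  apply: compact_lsc_argmin => //.
    by case: MA_neq0 => x [_ Ax]; exists x.
  apply: lsc_on_slice g_lsc _.
  by rewrite /mclosed_ball/= mdistxx ltW.
have [Ax0 x0_min] := x0_opt.
have [v gv] : exists v, g (x0, m0) = v%:E.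
  by exists (fine (g (x0, m0))); rewrite fineK// opt_fin.
rewrite gv in x0_min.
have loc x : A x -> g (x, m0) = v%:E -> locally_exact A g beta m0 x.
  by move=> Ax gx; apply: loc_exact; rewrite -g_exact; split; rewrite ?gx.
have [[L V] /= [nL /nbhs_ballP[e /= e_gt0 eV]] LV] :=
  near_penalty_ge _ _ _ _ _ _ _ _ _
    A_compact r_gt0 g_lsc beta_ge0 beta0 x0_min loc.
have nFar : \forall lambda \near +oo%R, forall x m, A x -> (e <= mdist m m0)%R ->
    v%:E <= penalty g beta m0 lambda (x, m).
  apply: far_penalty_ge F_bounded _ _ _ _ => //; last 2 first.
  - exact: beta_gt0.
  - exact: ltW.
  by move=> t; rewrite le_eqVlt => /predU1P[->//|et]; exact/ltW/beta_incr/et/ltW.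
have [lambda [lambda_ge0 Llambda far]] : exists lambda, [/\ (0 <= lambda)%R, L lambda &
    forall x m, A x -> (e <= mdist m m0)%R ->
    v%:E <= penalty g beta m0 lambda (x, m)].
  near (+oo%R : set_system R) => l; exists l; split; near: l => //.
  by apply: nbhs_pinfty_ge; exact: num_real.
apply: (globally_exact_of_lower_bound _ _ _ _ _ _ _ lambda v x0) => //.
move=> x m Ax; have [em|me] := leP e (mdist m m0); first exact: far.
apply: (LV (lambda, m)) => //; split => //=; apply: eV.
by rewrite ballEmdist/= metric_sym.
Unshelve. all: by end_near. Qed.
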